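(* In the full feedback model, there exists an algorithm with regret $O(\tau(\mathcal{H}))$ (for every horizon $T$ and every adversary). Furthermore, no algorithm can guarantee regret less than $\tau(\mathcal{H})/2$.
   Context: Full feedback model: $\mathcal{H}$ is a class of functions $\mathcal{X}\to\mathcal{Y}$ and $\ell:\mathcal{Y}\times\mathcal{Y}\to[0,1]$ is a loss that is a metric on $\mathcal{Y}$. An adversary fixes $f_0\in\mathcal{H}$; in each round $t=1,\dots,T$ it chooses $x_t\in\mathcal{X}$, the learner predicts $y_t\in\mathcal{Y}$, incurs loss $\ell(y_t,f_0(x_t))$, and then observes $f_0(x_t)$. Regret is the total loss $\sum_t\ell(y_t,f_0(x_t))$. An $(\mathcal{X},\mathcal{Y})$-tree of cost $c$ is a rooted binary tree in which each interior node has two children and is labeled by a triple $(x,y_1,y_2)$ with $x\in\mathcal{X}$, $y_1,y_2\in\mathcal{Y}$, such that for every leaf the sum of $\ell(y_1,y_2)$ over the interior nodes on the root-to-leaf path is at least $c$. It is $\mathcal{H}$-satisfiable if each leaf can be labeled by some $f\in\mathcal{H}$ such that for each interior node $(x,y_1,y_2)$, all leaves of its left subtree satisfy $f(x)=y_1$ and all leaves of its right subtree satisfy $f(x)=y_2$. The tree dimension $\tau(\mathcal{H})$ is the maximum cost of an $\mathcal{H}$-satisfiable $(\mathcal{X},\mathcal{Y})$-tree. *)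

(* Defs.v *)
From mathcomp Require Import all_boot all_order all_algebra.
From mathcomp Require Import all_classical all_reals all_analysis.

Set Implicit Arguments.
Unset Strict Implicit.
Unset Printing Implicit Defensive.

Import Order.TTheory GRing.Theory Num.Theory.

Local Open Scope classical_set_scope.
Local Open Scope ring_scope.

(* The loss is the distance [mdist] of the metric space [Y]; its range [0, 1]
   is the hypothesis [unit_loss]. *)
Definition unit_loss (R : realType) (Y : metricType R) : Prop :=
  forall y y' : Y, 0 <= mdist y y' <= 1.

(* A (deterministic) learner maps the past pairs (x_s, f0 x_s), oldest first,
   and the current query to a prediction. Its own past predictions are a
   function of this history, so they need not be an input. *)
Definition learner (X Y : Type) : Type := seq (X * Y) -> X -> Y.

Section Game.
Variables (R : realType) (X : Type) (Y : metricType R).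

Definition history (f0 : X -> Y) (xs : seq X) : seq (X * Y) :=
  [seq (x, f0 x) | x <- xs].

(* Total loss over T rounds against the adversary that fixes [f0] and queries
   xs_0, ..., xs_(T-1). The plays of [A] against an adversary choosing x_t as a
   function of the past predictions are exactly those obtained by letting [xs]
   range over all tuples, since the predictions of [A] are determined by [f0]
   and the previous queries. *)
Definition regret (A : learner X Y) (f0 : X -> Y) (T : nat) (xs : T.-tuple X)
    : R :=
  \sum_(t < T) mdist (A (history f0 (take t xs)) (tnth xs t))
                     (f0 (tnth xs t)).

(* A randomized learner is a random choice [A w] of a learner, with [w] in a
   probability space. *)
Definition measurable_regret d (W : measurableType d) (H : set (X -> Y))
    (A : W -> learner X Y) : Prop :=
  forall (T : nat) (f0 : X -> Y) (xs : T.-tuple X), H f0 ->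
    measurable_fun [set: W] (fun w => regret (A w) f0 xs).

End Game.

(* Finite binary trees whose interior nodes are labeled by (x, y1, y2) and
   whose leaves are labeled by elements of [L]. *)
Inductive tree (X Y L : Type) : Type :=
| Leaf of L
| Node of X & Y & Y & tree X Y L & tree X Y L.

Section Tree.
Variables (R : realType) (X : Type) (Y : metricType R).

Definition xytree : Type := tree X Y unit.

Fixpoint erase_leaves (L : Type) (t : tree X Y L) : xytree :=
  match t with
  | Leaf _ => Leaf X Y tt
  | Node x y1 y2 l r => Node x y1 y2 (erase_leaves l) (erase_leaves r)
  end.

Fixpoint all_leaves (L : Type) (P : L -> Prop) (t : tree X Y L) : Prop :=
  match t with
  | Leaf f => P f
  | Node _ _ _ l r => all_leaves P l /\ all_leaves P r
  end.

(* For each leaf, the sum of mdist y1 y2 over the interior nodes above it. *)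
Fixpoint path_sums (t : xytree) : seq R :=
  match t with
  | Leaf _ => [:: 0]
  | Node _ y1 y2 l r =>
      [seq mdist y1 y2 + s | s <- path_sums l ++ path_sums r]
  end.

Definition has_cost (c : R) (t : xytree) : Prop :=
  forall s, s \in path_sums t -> c <= s.

Fixpoint respects_nodes (t : tree X Y (X -> Y)) : Prop :=
  match t with
  | Leaf _ => True
  | Node x y1 y2 l r =>
      [/\ all_leaves (fun f => f x = y1) l,
          all_leaves (fun f => f x = y2) r,
          respects_nodes l & respects_nodes r]
  end.

Definition satisfiable (H : set (X -> Y)) (t : xytree) : Prop :=
  exists s : tree X Y (X -> Y),
    [/\ erase_leaves s = t, all_leaves H s & respects_nodes s].

Definition satisfiable_costs (H : set (X -> Y)) : set R :=
  [set c | exists t : xytree, has_cost c t /\ satisfiable H t].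

(* The maximum cost when it exists; otherwise the supremum, possibly +oo. *)
Definition tree_dim (H : set (X -> Y)) : \bar R :=
  ereal_sup [set c%:E | c in satisfiable_costs H].

Definition tree_dim_attained (H : set (X -> Y)) : Prop :=
  exists c : R, satisfiable_costs H c /\ tree_dim H = c%:E.

End Tree.

(* Main.v *)
(** Write V_y for the functions of a class V taking the value y at the query x.
Joining a tree for V_y and a tree for V_y' under a root labeled (x, y, y') gives
tau(V) >= l(y, y') + min(tau(V_y), tau(V_y')). A learner that predicts a y
(nearly) maximizing tau(V_y) over the version space V therefore loses at most the
drop tau(V) - tau(V_y') when the true label is y', and the drops telescope.

For the lower bound, the adversary walks down a tree: by the triangle inequality,
at each node one of the two labels costs the learner at least l(y1, y2) / 2 in
expectation. A deterministic learner is a randomized one over a one-point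
probability space. *)

Require Import Defs.
From mathcomp Require Import all_boot all_order all_algebra.
From mathcomp Require Import all_classical all_reals all_analysis.
From mathcomp Require Import measurable_realfun lra.

Set Implicit Arguments.
Unset Strict Implicit.
Unset Printing Implicit Defensive.

Import Order.TTheory GRing.Theory Num.Theory.

Local Open Scope classical_set_scope.
Local Open Scope ring_scope.

Section TreeDimension.
Variables (R : realType) (X : Type) (Y : metricType R).
Implicit Types (H : set (X -> Y)) (f : X -> Y) (x : X) (y : Y) (t : xytree X Y).

(** * Satisfiable trees, their costs and the tree dimension *)

Definition labeled H x y : set (X -> Y) := [set f | H f /\ f x = y].

Lemma all_leavesI (L : Type) (P Q : L -> Prop) (s : tree X Y L) :
  all_leaves (fun a => P a /\ Q a) s <-> all_leaves P s /\ all_leaves Q s.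
Proof. by elim: s => //= x y1 y2 l [IHl IHl'] r [IHr IHr']; intuition. Qed.

Lemma satisfiable_leaf H u : satisfiable H (Leaf X Y u) <-> H !=set0.
Proof.
split=> [[s [st Hs _]]|[f Hf]]; last by exists (Leaf X Y f); case: u.
by case: s st Hs => //= f _ Hf; exists f.
Qed.

(** The constraint imposed by the root moves into the class, which makes satisfiability recursive;
    inductions on trees therefore generalize over [H]. *)
Lemma satisfiable_node H x y1 y2 l r :
  satisfiable H (Node x y1 y2 l r) <->
  satisfiable (labeled H x y1) l /\ satisfiable (labeled H x y2) r.
Proof.
split=> [[s []]|].
  case: s => //= x' y1' y2' l' r' [-> -> -> <- <-] [Hl Hr] [l1 r1 ll rr].
  by split; [exists l'|exists r']; split=> //; apply/all_leavesI.
move=> [[l' [<- /all_leavesI[Hl l1] ll]] [r' [<- /all_leavesI[Hr r1] rr]]].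
by exists (Node x y1 y2 l' r').
Qed.

Lemma satisfiable_neq0 H t : satisfiable H t -> H !=set0.
Proof.
elim: t H => [u H /satisfiable_leaf//|x y1 y2 l IHl r _ H].
by move=> /satisfiable_node[/IHl[f [Hf _]] _]; exists f.
Qed.

Lemma has_cost_node (c : R) x y1 y2 l r :
  has_cost c (Node x y1 y2 l r) <->
  has_cost (c - mdist y1 y2) l /\ has_cost (c - mdist y1 y2) r.
Proof.
split=> [h|[hl hr] _ /mapP[s + ->]].
  split=> s hs; rewrite lerBlDl; apply: h; rewrite map_f// mem_cat hs//.
  by rewrite orbT.
by rewrite mem_cat -lerBlDl => /orP[/hl|/hr].
Qed.

Lemma satisfiable_costs0 H : H !=set0 -> satisfiable_costs H 0.
Proof.
move=> H0; exists (Leaf X Y tt); split; last exact/satisfiable_leaf.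
by move=> s /=; rewrite inE => /eqP ->.
Qed.

Lemma satisfiable_costs_le H (c c' : R) :
  c' <= c -> satisfiable_costs H c -> satisfiable_costs H c'.
Proof.
by move=> cc' [t [ct Ht]]; exists t; split=> // s /ct; exact: le_trans.
Qed.

(** The common cost [c] plays the part of the minimum of the two restricted tree dimensions. *)
Lemma satisfiable_costs_node H x y1 y2 (c : R) :
  satisfiable_costs (labeled H x y1) c ->
  satisfiable_costs (labeled H x y2) c ->
  satisfiable_costs H (mdist y1 y2 + c).
Proof.
move=> [l [cl Hl]] [r [cr Hr]]; exists (Node x y1 y2 l r).
by split; [apply/has_cost_node; rewrite addrAC subrr add0r|exact/satisfiable_node].
Qed.

(** Costs are closed downwards; the inequality is strict because the supremum itself may fail to be
    a cost. *)
Lemma satisfiable_costs_lt_tree_dim H (c : R) :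
  (c%:E < tree_dim H)%E -> satisfiable_costs H c.
Proof.
move=> /ereal_sup_gt[_ [c' Hc' <-]]; rewrite lte_fin => /ltW cc'.
exact: satisfiable_costs_le Hc'.
Qed.

Lemma satisfiable_costs_le_tree_dim H (c : R) :
  satisfiable_costs H c -> (c%:E <= tree_dim H)%E.
Proof. by move=> Hc; apply: ereal_sup_ubound; exists c. Qed.

Lemma tree_dim_ge0 H : H !=set0 -> (0 <= tree_dim H)%E.
Proof. by move=> H0; exact/satisfiable_costs_le_tree_dim/satisfiable_costs0. Qed.

Lemma tree_dim_le H H' : H `<=` H' -> (tree_dim H <= tree_dim H')%E.
Proof.
move=> HH'; apply: ereal_sup_le => _ [c [t [ct [s [st Hs rs]]]] <-].
exists c => //; exists t; split=> //; exists s; split=> //.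
by elim: {st rs} s Hs => [f /HH'//|x y1 y2 l IHl r IHr /= [/IHl ? /IHr]].
Qed.

Lemma tree_dim_fin H :
  H !=set0 -> (tree_dim H < +oo)%E -> tree_dim H \is a fin_num.
Proof. by move=> H0 Hoo; rewrite ge0_fin_numE// tree_dim_ge0. Qed.

(** A tree with a single interior node, queried at [x], has this cost. *)
Lemma mdist_le_tree_dim H x f g :
  H f -> H g -> ((mdist (f x) (g x))%:E <= tree_dim H)%E.
Proof.
move=> Hf Hg; apply: satisfiable_costs_le_tree_dim.
rewrite -[mdist _ _]addr0; apply: (@satisfiable_costs_node _ x).
  by apply: satisfiable_costs0; exists f.
by apply: satisfiable_costs0; exists g.
Qed.

(** * Upper bound: near-optimal predictions on the version space *)

(* The supremum over labels of the tree dimension of the restricted class need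
   not be attained, hence the slack e. *)
Definition near_optimal H (e : R) x y : Prop :=
  forall f, H f ->
    ((mdist y (f x))%:E + tree_dim (labeled H x (f x)) <= tree_dim H + e%:E)%E.

Lemma near_optimal_exists H (e : R) x :
  H !=set0 -> (tree_dim H < +oo)%E -> 0 < e ->
  exists y, near_optimal H e x y.
Proof.
move=> [f0 Hf0] Hoo e0.
have dimP f : H f ->
    exists2 a, tree_dim (labeled H x (f x)) = a%:E & (a%:E <= tree_dim H)%E.
  move=> Hf.
  have le : (tree_dim (labeled H x (f x)) <= tree_dim H)%E.
    by apply: tree_dim_le => g [].
  exists (fine (tree_dim (labeled H x (f x)))); rewrite fineK//.
  - by apply: tree_dim_fin (le_lt_trans le Hoo); exists f.
  - by apply: tree_dim_fin (le_lt_trans le Hoo); exists f.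
have dimH : tree_dim H \is a fin_num by apply: tree_dim_fin => //; exists f0.
pose D := [set tree_dim (labeled H x (f x)) | f in H].
have Dub : (ereal_sup D <= tree_dim H)%E.
  by apply: ge_ereal_sup => _ [f Hf <-]; case: (dimP f Hf) => a ->.
have Dfin : ereal_sup D \is a fin_num.
  rewrite ge0_fin_numE ?(le_lt_trans Dub)//.
  apply: (@le_trans _ _ (tree_dim (labeled H x (f0 x)))).
    by apply: tree_dim_ge0; exists f0.
  by apply: ereal_sup_ubound; exists f0.
(* The prediction is the value at [x] of a [g] whose restricted tree dimension is within [e] of the
   supremum. *)
have [_ [g Hg <-] gD] := ub_ereal_sup_adherent e0 Dfin.
exists (g x) => f Hf; have [a fa _] := dimP f Hf.
(* The cost [a - e] lies strictly below the tree dimensions of both restricted classes, so trees of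
   that cost exist for both and can be joined. *)
have ae : ((a - e)%:E < tree_dim (labeled H x (g x)))%E.
  apply: le_lt_trans gD; rewrite EFinB leeB// -fa.
  by apply: ereal_sup_ubound; exists f.
have /satisfiable_costs_le_tree_dim : satisfiable_costs H (mdist (g x) (f x) + (a - e)).
  apply: (@satisfiable_costs_node _ x); apply: satisfiable_costs_lt_tree_dim => //.
  by rewrite fa lte_fin gtrBl.
by rewrite fa -(fineK dimH) -!EFinD !lee_fin addrA lerBlDr.
Qed.

(** [Y] is not assumed inhabited, so the default value of [xget] is taken from a function [f]. *)
Definition predict f H (e : R) x : Y := xget (f x) (near_optimal H e x).

Lemma predictP f H (e : R) x :
  H !=set0 -> (tree_dim H < +oo)%E -> 0 < e -> near_optimal H e x (predict f H e x).
Proof. by move=> H0 Hoo e0; apply: xgetPex; exact: near_optimal_exists. Qed.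

(* The slacks e / 2, e / 4, etc. add up to less than e. *)
Fixpoint version_space_learner f H (e : R) (h : seq (X * Y)) (x : X) : Y :=
  if h is (x', y') :: h' then
    version_space_learner f (labeled H x' y') (e / 2) h' x
  else predict f H (e / 2) x.

Lemma regret0 (A : learner X Y) f (xs : 0.-tuple X) : regret A f xs = 0.
Proof. by rewrite /regret big_ord0. Qed.

(** The later rounds form a game against the learner with the first pair built into its history;
    this drives the inductions over rounds and over trees. *)
Lemma regret_cons (A : learner X Y) f T x (xs : T.-tuple X) :
  regret A f [tuple of x :: xs] =
  mdist (A [::] x) (f x) + regret (fun h => A ((x, f x) :: h)) f xs.
Proof.
rewrite /regret big_ord_recl tnth0; congr (_ + _).
by apply: eq_bigr => i _; rewrite tnthS.
Qed.

Lemma regret_ge0 (A : learner X Y) f T (xs : T.-tuple X) : 0 <= regret A f xs.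
Proof. by apply: sumr_ge0 => i _; exact: mdist_ge0. Qed.

(** Induction on [T] for all [H] and [e]: the first loss is at most the drop in tree dimension plus
    [e / 2], and the later rounds cost at most what remains of it plus [e / 2]. *)
Lemma version_space_learner_regret f H (e : R) f0 T (xs : T.-tuple X) :
  H f0 -> (tree_dim H < +oo)%E -> 0 < e ->
  ((regret (version_space_learner f H e) f0 xs)%:E <= tree_dim H + e%:E)%E.
Proof.
elim: T xs H e => [|T IHT] xs H e Hf0 Hoo e0.
  rewrite regret0 adde_ge0 ?lee_fin ?(ltW e0)//.
  by apply: tree_dim_ge0; exists f0.
case/tupleP: xs => x xs; rewrite regret_cons.
have e20 : 0 < e / 2 by rewrite divr_gt0.
have H0 : H !=set0 by exists f0.
have le : (tree_dim (labeled H x (f0 x)) <= tree_dim H)%E.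
  by apply: tree_dim_le => g [].
have := IHT xs (labeled H x (f0 x)) (e / 2) (conj Hf0 erefl) (le_lt_trans le Hoo) e20.
have := @predictP f H (e / 2) x H0 Hoo e20 f0 Hf0.
have L0 : labeled H x (f0 x) !=set0 by exists f0.
rewrite -(fineK (tree_dim_fin L0 (le_lt_trans le Hoo))) -(fineK (tree_dim_fin H0 Hoo)).
rewrite -!EFinD !lee_fin /=; lra.
Qed.

Lemma exists_learner_regret_le H : H !=set0 ->
  exists A : learner X Y, forall T f0 (xs : T.-tuple X), H f0 ->
    ((regret A f0 xs)%:E <= 2%:E * tree_dim H)%E.
Proof.
move=> H0; have [f Hf] := H0.
have [Hoo|] := ltP (tree_dim H) +oo%E; last first.
  rewrite leye_eq => /eqP ->; exists (fun=> f) => T f0 xs _.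
  by rewrite gt0_muley ?lte_fin// leey.
have [d0|d0] := ltP 0%E (tree_dim H).
  have dE := fineK (tree_dim_fin H0 Hoo).
  (* The total slack is chosen equal to the tree dimension, whence the factor 2. *)
  have e0 : 0 < fine (tree_dim H) by rewrite -lte_fin dE.
  exists (version_space_learner f H (fine (tree_dim H))) => T f0 xs Hf0.
  apply: le_trans (version_space_learner_regret f xs Hf0 Hoo e0) _.
  by rewrite -dE -EFinD -EFinM lee_fin /= mulr_natl mulr2n.
(* No positive slack fits here, but all functions of [H] are at distance 0 everywhere, so predicting
   with any one of them is free. *)
have dE : tree_dim H = 0%E by apply/eqP; rewrite eq_le d0 tree_dim_ge0.
exists (fun=> f) => T f0 xs Hf0; rewrite dE mule0 lee_fin sumr_le0// => i _.
by have := mdist_le_tree_dim (tnth xs i) Hf Hf0; rewrite dE lee_fin.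
Qed.

(** * Lower bound for randomized learners *)

Section Lower.
Variables (d : measure_display) (W : measurableType d) (P : probability W R).
Implicit Types A : W -> learner X Y.

Lemma measurable_first_loss H A x f : measurable_regret H A -> H f ->
  measurable_fun [set: W] (fun w => mdist (A w [::] x) (f x)).
Proof.
move=> mA Hf; have := mA 1%N f [tuple x] Hf; congr measurable_fun.
by apply/funext => w; rewrite regret_cons regret0 addr0.
Qed.

(** The regret of the remaining game is the total regret minus the first loss, both measurable. *)
Lemma measurable_regret_labeled H A x y : measurable_regret H A ->
  measurable_regret (labeled H x y) (fun w h => A w ((x, y) :: h)).
Proof.
move=> mA T f xs [Hf <-].
have := measurable_funB (mA _ f [tuple of x :: xs] Hf) (measurable_first_loss x mA Hf).
congr measurable_fun; apply/funext => w /=.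
by rewrite regret_cons addrAC subrr add0r.
Qed.

(** Nonnegativity replaces integrability. *)
Lemma ge0_expectationD (U V : W -> R) :
  measurable_fun [set: W] U -> measurable_fun [set: W] V ->
  (forall w, 0 <= U w) -> (forall w, 0 <= V w) ->
  ('E_P[fun w => (U w + V w)%R] = 'E_P[U] + 'E_P[V])%E.
Proof.
move=> mU mV U0 V0; rewrite unlock; under eq_integral do rewrite EFinD.
rewrite ge0_integralD//.
- by move=> w _; rewrite lee_fin.
- exact/measurable_EFinP.
- by move=> w _; rewrite lee_fin.
- exact/measurable_EFinP.
Qed.

Lemma exists_expected_regret_ge H A (c : R) :
  measurable_regret H A -> satisfiable_costs H c ->
  exists T f (xs : T.-tuple X),
    H f /\ ((c / 2)%:E <= 'E_P[fun w => regret (A w) f xs])%E.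
Proof.
move=> mA [t [ct Ht]]; elim: t H A c mA ct Ht => [u|x y1 y2 l IHl r IHr] H A c mA ct.
  move=> /satisfiable_leaf[f Hf]; exists 0%N, f, [tuple]; split=> //.
  apply: (@le_trans _ _ 0%E); last by apply: expectation_ge0 => w; exact: regret_ge0.
  (* The only path sum of a leaf is 0, so [c <= 0] and zero rounds suffice. *)
  by rewrite lee_fin pmulr_lle0// ct//= inE.
move=> /satisfiable_node[Hl Hr]; have /has_cost_node[cl cr] := ct.
(* Here [y] is either label of the root: [later] comes from the induction hypothesis on its subtree,
   [now] from the query at the root. *)
have extend y T f (xs : T.-tuple X) : labeled H x y f ->
    (((c - mdist y1 y2) / 2)%:E
      <= 'E_P[fun w => regret (fun h => A w ((x, y) :: h)) f xs])%E ->
    ((mdist y1 y2 / 2)%:E <= 'E_P[fun w => mdist (A w [::] x) y])%E ->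
    exists T f (xs : T.-tuple X),
      H f /\ ((c / 2)%:E <= 'E_P[fun w => regret (A w) f xs])%E.
  move=> Hf later now; exists T.+1, f, [tuple of x :: xs]; split; first by case: Hf.
  have -> : c / 2 = mdist y1 y2 / 2 + (c - mdist y1 y2) / 2 by lra.
  under [X in ('E_P[X])%E]eq_fun do rewrite regret_cons.
  rewrite (ge0_expectationD (measurable_first_loss x mA Hf.1)).
  - by rewrite EFinD leeD// Hf.2.
  - by rewrite Hf.2; exact: measurable_regret_labeled mA _ _ xs Hf.
  - by move=> w; exact: mdist_ge0.
  - by move=> w; exact: regret_ge0.
have [T1 [f1 [xs1 [Hf1 E1]]]] := IHl _ _ _ (measurable_regret_labeled mA) cl Hl.
have [T2 [f2 [xs2 [Hf2 E2]]]] := IHr _ _ _ (measurable_regret_labeled mA) cr Hr.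
have [|lt1] := leP (mdist y1 y2 / 2)%:E ('E_P[fun w => mdist (A w [::] x) y1])%E.
  exact: extend E1.
have [|lt2] := leP (mdist y1 y2 / 2)%:E ('E_P[fun w => mdist (A w [::] x) y2])%E.
  exact: extend E2.
have m1 := measurable_first_loss x mA Hf1.1; rewrite Hf1.2 in m1.
have m2 := measurable_first_loss x mA Hf2.1; rewrite Hf2.2 in m2.
(* If both expected losses were below half of [mdist y1 y2], their sum would be below it, against
   the triangle inequality integrated over [P]. *)
have := lteD lt1 lt2; rewrite -(ge0_expectationD m1 m2); last 2 first.
- by move=> w; exact: mdist_ge0.
- by move=> w; exact: mdist_ge0.
rewrite -EFinD -splitr ltNge -(expectation_cst P) => /negP[].
rewrite unlock; apply: ge0_le_integral => //=.
- by move=> w _; rewrite lee_fin mdist_ge0.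
- by apply/measurable_EFinP; exact: measurable_funD.
- by move=> w _; rewrite lee_fin (metric_sym _ y1) metric_triangle.
Qed.

(** A bound [r] below half the supremum leaves room for a cost [c > 2 * r]; when the maximum is
    attained, it serves as [c] and even excludes a strict bound that is not uniform. *)
Lemma expected_regret_not_lt_half_tree_dim H A : measurable_regret H A ->
  (~ exists r : R, (r%:E < (2^-1)%:E * tree_dim H)%E /\
      forall T f (xs : T.-tuple X), H f ->
        ('E_P[fun w => regret (A w) f xs] <= r%:E)%E) /\
  (tree_dim_attained H ->
   ~ forall T f (xs : T.-tuple X), H f ->
       ('E_P[fun w => regret (A w) f xs] < (2^-1)%:E * tree_dim H)%E).
Proof.
move=> mA; split=> [[r [+ Ar]]|[c [Hc ->]] AH].
  rewrite muleC lte_pdivlMr// => /ereal_sup_gt[_ [c Hc <-]]; rewrite -EFinM lte_fin => rc.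
  have [T [f [xs [Hf]]]] := exists_expected_regret_ge mA Hc.
  by move=> /le_trans/(_ (Ar _ _ _ Hf)); rewrite lee_fin; lra.
have [T [f [xs [Hf]]]] := exists_expected_regret_ge mA Hc.
by rewrite leNgt EFinM muleC AH// => /negP[].
Qed.

End Lower.

Lemma regret_not_lt_half_tree_dim H (A : learner X Y) :
  (~ exists r : R, (r%:E < (2^-1)%:E * tree_dim H)%E /\
      forall T f (xs : T.-tuple X), H f -> regret A f xs <= r) /\
  (tree_dim_attained H ->
   ~ forall T f (xs : T.-tuple X), H f ->
       ((regret A f xs)%:E < (2^-1)%:E * tree_dim H)%E).
Proof.
have mA : measurable_regret H (fun _ : unit => A).
  by move=> T f xs _; exact: measurable_cst.
have EA T f (xs : T.-tuple X) :
    ('E_(dirac tt : probability unit R)[fun=> regret A f xs] = (regret A f xs)%:E)%E.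
  exact: expectation_cst.
have [A1 A2] := expected_regret_not_lt_half_tree_dim (dirac tt) mA.
split=> [[r [rH Ar]]|/A2 {}A2 AH].
  by apply: A1; exists r; split=> // T f xs Hf; rewrite EA lee_fin Ar.
by apply: A2 => T f xs Hf; rewrite EA AH.
Qed.

End TreeDimension.

Theorem mainTheorem7 (R : realType) :
  (* upper bound, with an absolute constant C *)
  (exists C : R, 0 < C /\
    forall (X : Type) (Y : metricType R) (H : set (X -> Y)),
      unit_loss Y -> H !=set0 ->
      exists A : learner X Y,
        forall (T : nat) (f0 : X -> Y) (xs : T.-tuple X), H f0 ->
          ((regret A f0 xs)%:E <= C%:E * tree_dim H)%E)
  /\
  (* lower bounds *)
  (forall (X : Type) (Y : metricType R) (H : set (X -> Y)),
    unit_loss Y -> H !=set0 ->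
    (* deterministic learners *)
    (~ exists (A : learner X Y) (r : R),
         (r%:E < (2^-1)%:E * tree_dim H)%E /\
         forall (T : nat) (f0 : X -> Y) (xs : T.-tuple X), H f0 ->
           regret A f0 xs <= r) /\
    (tree_dim_attained H ->
     ~ exists A : learner X Y,
         forall (T : nat) (f0 : X -> Y) (xs : T.-tuple X), H f0 ->
           ((regret A f0 xs)%:E < (2^-1)%:E * tree_dim H)%E) /\
    (* randomized learners, in expectation *)
    (forall (d : measure_display) (W : measurableType d)
            (P : probability W R) (A : W -> learner X Y),
       measurable_regret H A ->
       (~ exists r : R,
            (r%:E < (2^-1)%:E * tree_dim H)%E /\
            forall (T : nat) (f0 : X -> Y) (xs : T.-tuple X), H f0 ->
              ('E_P[fun w => regret (A w) f0 xs] <= r%:E)%E) /\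
       (tree_dim_attained H ->
        ~ forall (T : nat) (f0 : X -> Y) (xs : T.-tuple X), H f0 ->
            ('E_P[fun w => regret (A w) f0 xs] < (2^-1)%:E * tree_dim H)%E))).
Proof.
split.
  exists 2; split=> // X Y H _ H0.
  by have [A hA] := exists_learner_regret_le H0; exists A => T f0 xs; exact: hA.
move=> X Y H _ _; split; last split.
- move=> [A [r [rH Ar]]]; have [+ _] := regret_not_lt_half_tree_dim H A.
  by apply; exists r; split=> // T f0 xs; exact: Ar.
- move=> att [A AH]; have [_] := regret_not_lt_half_tree_dim H A.
  by move=> /(_ att); apply=> T f0 xs; exact: AH.
- move=> d W P A mA; have [A1 A2] := expected_regret_not_lt_half_tree_dim P mA.
  split=> [[r [rH Ar]]|att AH].
    by apply: A1; exists r; split=> // T f0 xs; exact: Ar.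
  by apply: (A2 att) => T f0 xs; exact: AH.
Qed.
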